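(* Let $R$ be a semicommutative ring and $\alpha$ a compatible endomorphism of $R$. Then $R$ is a right $\mathfrak{cP}$-Baer ring if and only if the skew Laurent polynomial ring $R[x,x^{-1};\alpha]$ is a right $\mathfrak{cP}$-Baer ring.
   Context: All rings are associative with identity (not necessarily commutative). For a subset $S$ of a ring $R$, $r_R(S)=\{a\in R : sa=0 \text{ for all } s\in S\}$. A ring $R$ is right $\mathfrak{cP}$-Baer if for every idempotent $e=e^2\in R$ there is an idempotent $c=c^2\in R$ with $r_R(eR)=cR$. A ring $R$ is semicommutative if for all $a,b\in R$, $ab=0$ implies $aRb=0$. A ring endomorphism $\alpha$ of $R$ is compatible if for all $a,b\in R$: $ab=0$ if and only if $a\alpha(b)=0$; a compatible endomorphism is injective. For an injective endomorphism $\alpha$, the skew polynomial ring $R[x;\alpha]$ (polynomials with left coefficients and $xa=\alpha(a)x$) has $\{x^j\}_{j\ge 0}$ as a left Ore set, and $R[x,x^{-1};\alpha]$ is the corresponding left quotient ring. Its elements are finite sums of elements $x^{-j}rx^i$ with $r\in R$, $i,j\ge 0$, with $xr=\alpha(r)x$ and $rx^{-1}=x^{-1}\alpha(r)$ for $r\in R$. *)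

(* Defs.v *)
From HB Require Import structures.
From mathcomp Require Import all_boot all_algebra.
From mathcomp Require Import finmap.
From mathcomp Require Import monalg zify.

Set Implicit Arguments.
Unset Strict Implicit.
Unset Printing Implicit Defensive.

Import GRing.Theory.
Local Open Scope ring_scope.
Local Open Scope quotient_scope.

(* A pzRingType is an associative ring with identity, not necessarily         *)
(* commutative and possibly zero.                                             *)

Definition semicommutative (R : pzRingType) : Prop :=
  forall a b : R, a * b = 0 -> forall r : R, a * r * b = 0.

Definition compatible (R : pzRingType) (alpha : {rmorphism R -> R}) : Prop :=
  forall a b : R, a * b = 0 <-> a * alpha b = 0.

Definition right_annihilator (R : pzRingType) (S : R -> Prop) : R -> Prop :=
  fun a => forall s : R, S s -> s * a = 0.

Definition right_principal (R : pzRingType) (e : R) : R -> Prop :=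
  fun a => exists r : R, a = e * r.

Definition idempotent_elt (R : pzRingType) (e : R) : Prop := e * e = e.

Definition right_cP_Baer (R : pzRingType) : Prop :=
  forall e : R, idempotent_elt e ->
  exists c : R, idempotent_elt c /\
    forall a : R,
      right_annihilator (right_principal e) a <-> right_principal c a.

Lemma compatible_inj (R : pzRingType) (alpha : {rmorphism R -> R}) :
  compatible alpha -> injective alpha.
Proof.
move=> Ha; apply: raddf_inj => a a0.
by rewrite -[a]mul1r; apply/(Ha 1 a); rewrite a0 mulr0.
Qed.

(* R[x; alpha]: {malg R[nat]} is the group of finitely supported families     *)
(* (f@_i) of elements of R, and f stands for \sum_i f@_i x^i.                 *)

Definition skew_poly (R : pzRingType) (alpha : {rmorphism R -> R}) : Type :=
  {malg R[nat]}.

HB.instance Definition _ (R : pzRingType) (alpha : {rmorphism R -> R}) :=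
  GRing.Zmodule.copy (skew_poly alpha) {malg R[nat]}.

Definition skew_monom (R : pzRingType) (alpha : {rmorphism R -> R})
    (c : R) (i : nat) : skew_poly alpha := << c *g i >>.

Definition skew_coef (R : pzRingType) (alpha : {rmorphism R -> R})
    (i : nat) (f : skew_poly alpha) : R := mcoeff i f.

Arguments skew_monom {R} alpha.

(* (a x^i) (b x^j) = a alpha^i(b) x^(i+j) *)
HB.lock Definition skew_mul (R : pzRingType) (alpha : {rmorphism R -> R})
    (f g : skew_poly alpha) : skew_poly alpha :=
  \sum_(i <- msupp f) \sum_(j <- msupp g)
     skew_monom alpha (skew_coef i f * iter i alpha (skew_coef j g)) (i + j).

Section SkewPoly.
Context (R : pzRingType) (alpha : {rmorphism R -> R}).
Local Notation P := (skew_poly alpha).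
Implicit Types (f g h : P) (a b c : R) (i j k : nat).

Local Notation skew_monom := (skew_monom alpha).
Local Notation skew_coef := (@skew_coef R alpha).
Local Notation skew_mul := (@skew_mul R alpha).

Definition skew_one : P := skew_monom 1 0.

Lemma iter_alpha_zmod i : zmod_morphism (iter i alpha).
Proof. by elim: i => [|i IHi] a b //=; rewrite IHi rmorphB. Qed.

Lemma iter_alpha_monoid i : monoid_morphism (iter i alpha).
Proof.
elim: i => [|i [IH1 IHM]]; split=> [|a b] //=.
  by rewrite IH1 rmorph1.
by rewrite IHM rmorphM.
Qed.

HB.instance Definition _ i :=
  GRing.isZmodMorphism.Build R R (iter i alpha) (iter_alpha_zmod i).
HB.instance Definition _ i :=
  GRing.isMonoidMorphism.Build R R (iter i alpha) (iter_alpha_monoid i).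

Lemma skew_polyP f g : (forall i, skew_coef i f = skew_coef i g) -> f = g.
Proof. by move=> fg; apply/malgP. Qed.

Lemma skew_coef_zmod i : zmod_morphism (skew_coef i).
Proof. by move=> f g; exact: mcoeffB. Qed.
HB.instance Definition _ i :=
  GRing.isZmodMorphism.Build P R (skew_coef i) (skew_coef_zmod i).

Lemma skew_monom_zmod i : zmod_morphism (skew_monom^~ i).
Proof. by move=> a b; exact: monalgUB. Qed.

Lemma skew_monom0 i : skew_monom 0 i = 0.
Proof. exact: monalgU0. Qed.
Lemma skew_monomD i : {morph skew_monom^~ i : a b / a + b}.
Proof. by move=> a b; exact: monalgUD. Qed.

Lemma skew_coef_monom c i j : skew_coef j (skew_monom c i) = c *+ (i == j).
Proof. exact: mcoeffU. Qed.

Lemma skew_polyE f : f = \sum_(i <- msupp f) skew_monom (skew_coef i f) i.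
Proof. exact: monalgE. Qed.

Lemma skew_mulw (d1 d2 : {fset nat}) f g :
  (msupp f `<=` d1)%fset -> (msupp g `<=` d2)%fset ->
  skew_mul f g = \sum_(i <- d1) \sum_(j <- d2)
     skew_monom (skew_coef i f * iter i alpha (skew_coef j g)) (i + j).
Proof.
move=> le_d1 le_d2; rewrite skew_mul.unlock (big_fset_incl _ le_d1) /=.
  apply/eq_bigr=> i _; apply/big_fset_incl => // j _ /mcoeff_outdom gj.
  by rewrite /skew_coef gj raddf0 mulr0 skew_monom0.
move=> i _ /mcoeff_outdom fi.
by rewrite big1 // => j _; rewrite /skew_coef fi mul0r skew_monom0.
Qed.

Lemma skew_mul0l : left_zero 0 skew_mul.
Proof. by move=> g; rewrite skew_mul.unlock msupp0 big_seq_fset0. Qed.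

Lemma skew_mul0r : right_zero 0 skew_mul.
Proof.
by move=> g; rewrite skew_mul.unlock big1 // => i _; rewrite msupp0 big_seq_fset0.
Qed.

Lemma skew_mulDl : left_distributive skew_mul +%R.
Proof.
move=> f g h.
rewrite (skew_mulw (msuppD_le f g) (fsubset_refl _)).
rewrite (skew_mulw (fsubsetUl _ (msupp g)) (fsubset_refl (msupp h))).
rewrite (skew_mulw (fsubsetUr (msupp f) _) (fsubset_refl (msupp h))).
rewrite -big_split /=; apply/eq_bigr=> i _.
rewrite -big_split /=; apply/eq_bigr=> j _.
by rewrite raddfD mulrDl skew_monomD.
Qed.

Lemma skew_mulDr : right_distributive skew_mul +%R.
Proof.
move=> h f g.
rewrite (skew_mulw (fsubset_refl _) (msuppD_le f g)).
rewrite (skew_mulw (fsubset_refl (msupp h)) (fsubsetUl _ (msupp g))).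
rewrite (skew_mulw (fsubset_refl (msupp h)) (fsubsetUr (msupp f) _)).
rewrite -big_split /=; apply/eq_bigr=> i _.
rewrite -big_split /=; apply/eq_bigr=> j _.
by rewrite !raddfD mulrDr skew_monomD.
Qed.

Lemma skew_mulUU a b i j :
  skew_mul (skew_monom a i) (skew_monom b j)
  = skew_monom (a * iter i alpha b) (i + j).
Proof.
by rewrite (skew_mulw msuppU_le msuppU_le) !big_seq_fset1 /skew_coef !mcoeffUU.
Qed.

Lemma skew_poly_ind (Q : P -> Prop) :
  Q 0 -> (forall f g, Q f -> Q g -> Q (f + g)) ->
  (forall c i, Q (skew_monom c i)) -> forall f, Q f.
Proof.
by move=> Q0 QD QU f; rewrite [f]skew_polyE; elim/big_ind: _.
Qed.

Lemma skew_mulA : associative skew_mul.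
Proof.
move=> f g h; elim/skew_poly_ind: f => [|f1 f2 E1 E2|a i].
- by rewrite !skew_mul0l.
- by rewrite !skew_mulDl E1 E2.
elim/skew_poly_ind: g => [|g1 g2 E1 E2|b j].
- by rewrite skew_mul0l !skew_mul0r skew_mul0l.
- by rewrite skew_mulDl !skew_mulDr skew_mulDl E1 E2.
elim/skew_poly_ind: h => [|h1 h2 E1 E2|c k].
- by rewrite !skew_mul0r.
- by rewrite !skew_mulDr E1 E2.
by rewrite !skew_mulUU rmorphM mulrA addnA iterD.
Qed.

Lemma skew_mul1l : left_id skew_one skew_mul.
Proof.
elim/skew_poly_ind => [|f g Ef Eg|c i]; first exact: skew_mul0r.
  by rewrite skew_mulDr Ef Eg.
by rewrite skew_mulUU mul1r.
Qed.

Lemma skew_mul1r : right_id skew_one skew_mul.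
Proof.
elim/skew_poly_ind => [|f g Ef Eg|c i]; first exact: skew_mul0l.
  by rewrite skew_mulDl Ef Eg.
by rewrite skew_mulUU rmorph1 mulr1 addn0.
Qed.

HB.instance Definition _ := GRing.Zmodule_isPzRing.Build P
  skew_mulA skew_mul1l skew_mul1r skew_mulDl skew_mulDr.

Lemma skew_monomM a b i j :
  skew_monom a i * skew_monom b j = skew_monom (a * iter i alpha b) (i + j).
Proof. exact: skew_mulUU. Qed.

Definition skewC c : P := skew_monom c 0.
Definition skewX : P := skew_monom 1 1.

Lemma skewC_zmod : zmod_morphism skewC.
Proof. exact: skew_monom_zmod. Qed.
Lemma skewC_monoid : monoid_morphism skewC.
Proof. by split=> // a b; rewrite /skewC skew_monomM. Qed.
HB.instance Definition _ := GRing.isZmodMorphism.Build R P skewC skewC_zmod.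
HB.instance Definition _ := GRing.isMonoidMorphism.Build R P skewC skewC_monoid.

Lemma skewXn n : skewX ^+ n = skew_monom 1 n.
Proof.
elim: n => [|n IHn] //.
by rewrite exprS IHn /skewX skew_monomM /= rmorph1 mulr1 add1n.
Qed.

Lemma skewCXn c n : skewC c * skewX ^+ n = skew_monom c n.
Proof. by rewrite skewXn skew_monomM mulr1. Qed.

(* The extension of alpha to R[x; alpha] fixing x; it satisfies               *)
(* x f = (skew_ext f) x.                                                      *)
Definition skew_ext f : P :=
  \sum_(i <- msupp f) skew_monom (alpha (skew_coef i f)) i.

Lemma skew_coef_ext i f : skew_coef i (skew_ext f) = alpha (skew_coef i f).
Proof.
rewrite /skew_ext raddf_sum /= [in RHS](skew_polyE f) raddf_sum rmorph_sum /=.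
by apply: eq_bigr => j _; rewrite !skew_coef_monom rmorphMn.
Qed.

Lemma skew_ext_zmod : zmod_morphism skew_ext.
Proof.
by move=> f g; apply: skew_polyP => i; rewrite [RHS]raddfB /= !skew_coef_ext !raddfB.
Qed.
HB.instance Definition _ := GRing.isZmodMorphism.Build P P skew_ext skew_ext_zmod.

Lemma skew_extU c i : skew_ext (skew_monom c i) = skew_monom (alpha c) i.
Proof.
by apply: skew_polyP => j; rewrite skew_coef_ext !skew_coef_monom rmorphMn.
Qed.

Lemma skew_ext_monoid : monoid_morphism skew_ext.
Proof.
split; first by rewrite skew_extU rmorph1.
move=> f g; elim/skew_poly_ind: f => [|f1 f2 E1 E2|a i].
- by rewrite mul0r raddf0 mul0r.
- by rewrite mulrDl !raddfD /= E1 E2 mulrDl.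
elim/skew_poly_ind: g => [|g1 g2 E1 E2|b j].
- by rewrite mulr0 raddf0 mulr0.
- by rewrite mulrDr !raddfD /= E1 E2 mulrDr.
by rewrite skew_monomM !skew_extU skew_monomM rmorphM -iterSr -iterS.
Qed.
HB.instance Definition _ := GRing.isMonoidMorphism.Build P P skew_ext skew_ext_monoid.

Lemma skewX_mul f : skewX * f = skew_ext f * skewX.
Proof.
elim/skew_poly_ind: f => [|f1 f2 E1 E2|a i].
- by rewrite raddf0 mulr0 mul0r.
- by rewrite mulrDr raddfD /= mulrDl E1 E2.
by rewrite skew_extU /skewX !skew_monomM /= rmorph1 mul1r mulr1 addnC.
Qed.

Lemma skew_coefMX f i : skew_coef i.+1 (f * skewX) = skew_coef i f.
Proof.
elim/skew_poly_ind: f => [|f1 f2 E1 E2|a j].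
- by rewrite mul0r !raddf0.
- by rewrite mulrDl !raddfD /= E1 E2.
by rewrite /skewX skew_monomM rmorph1 mulr1 !skew_coef_monom addn1 eqSS.
Qed.

(* Iterates of skew_ext, as ring endomorphisms. *)
Definition skew_extn n f : P := iter n skew_ext f.

Lemma skew_extn_zmod n : zmod_morphism (skew_extn n).
Proof. by elim: n => [|n IHn] f g //; rewrite /skew_extn /= [LHS](congr1 _ (IHn f g)) raddfB. Qed.
Lemma skew_extn_monoid n : monoid_morphism (skew_extn n).
Proof.
elim: n => [|n [IH1 IHM]] //; split=> [|f g]; rewrite /skew_extn /=.
  by rewrite [LHS](congr1 _ IH1) rmorph1.
by rewrite [LHS](congr1 _ (IHM f g)) rmorphM.
Qed.
HB.instance Definition _ n :=
  GRing.isZmodMorphism.Build P P (skew_extn n) (skew_extn_zmod n).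
HB.instance Definition _ n :=
  GRing.isMonoidMorphism.Build P P (skew_extn n) (skew_extn_monoid n).

Lemma skew_extnD m n f : skew_extn (m + n) f = skew_extn m (skew_extn n f).
Proof. exact: iterD. Qed.

Lemma skewXn_mul n f : skewX ^+ n * f = skew_extn n f * skewX ^+ n.
Proof.
elim: n => [|n IHn]; first by rewrite mul1r mulr1.
by rewrite exprS -mulrA IHn mulrA skewX_mul -mulrA -exprS.
Qed.

Lemma skew_extnXn m n : skew_extn m (skewX ^+ n) = skewX ^+ n.
Proof.
rewrite rmorphXn; congr (_ ^+ _); elim: m => //= m IHm.
by rewrite /skew_extn /= [LHS](congr1 _ IHm) /skewX skew_extU rmorph1.
Qed.

Context (alpha_inj : injective alpha).

Lemma skewX_lreg : GRing.lreg skewX.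
Proof.
move=> f g; rewrite !skewX_mul => fg; apply: skew_polyP => i.
apply: alpha_inj; rewrite -!skew_coef_ext.
by rewrite -(skew_coefMX (skew_ext f)) -(skew_coefMX (skew_ext g)) fg.
Qed.

Lemma skewXn_lreg n : GRing.lreg (skewX ^+ n).
Proof. exact: lregX skewX_lreg. Qed.

End SkewPoly.

Arguments skewC {R} alpha.
Arguments skewX {R} alpha.
Arguments skewXn_lreg {R alpha}.

(* R[x, x^-1; alpha], the left quotient ring of R[x; alpha] with respect to   *)
(* {x^j}: the pair (j, f) stands for the left fraction x^-j f. As powers of x *)
(* commute and are left regular, x^-j f = x^-k g iff x^k f = x^j g.           *)

Definition laurent_equiv (R : pzRingType) (alpha : {rmorphism R -> R})
    (u v : nat * skew_poly alpha) : bool :=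
  skewX alpha ^+ v.1 * u.2 == skewX alpha ^+ u.1 * v.2.

Section SkewLaurent.
Context (R : pzRingType) (alpha : {rmorphism R -> R}).
Context (alpha_inj : injective alpha).
Local Notation P := (skew_poly alpha).
Local Notation x := (skewX alpha).
Local Notation equiv := (@laurent_equiv R alpha).
Implicit Types f g h : P.

Lemma laurent_equiv_refl : reflexive equiv.
Proof. by move=> u; exact: eqxx. Qed.

Lemma laurent_equiv_sym : symmetric equiv.
Proof. by move=> u v; exact: eq_sym. Qed.

Lemma laurent_equiv_trans : transitive equiv.
Proof.
move=> [k g] [j f] [l h]; rewrite /laurent_equiv /= => /eqP fg /eqP gh.
apply/eqP/(skewXn_lreg alpha_inj k).
by rewrite mulrA -exprD addnC exprD -mulrA fg mulrA -exprD addnC exprD -mulrA gh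
  !mulrA -!exprD addnC.
Qed.

Definition laurent_equivalence :=
  EquivRel equiv laurent_equiv_refl laurent_equiv_sym laurent_equiv_trans.

Definition skew_laurent : Type := {eq_quot laurent_equivalence}.
Local Notation L := skew_laurent.
HB.instance Definition _ : EqQuotient _ laurent_equivalence L := EqQuotient.on L.
HB.instance Definition _ := Choice.on L.

Definition laurent_frac j f : L := \pi_L (j, f).

Lemma laurent_fracP j k f g :
  laurent_frac j f = laurent_frac k g <-> x ^+ k * f = x ^+ j * g.
Proof. by split=> [/eqmodP/eqP|/eqP fg] //; apply/eqmodP. Qed.

Lemma laurent_frac_repr (u : L) : laurent_frac (repr u).1 (repr u).2 = u.
Proof. by rewrite /laurent_frac -surjective_pairing reprK. Qed.

Lemma laurent_ind (Q : L -> Prop) :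
  (forall j f, Q (laurent_frac j f)) -> forall u : L, Q u.
Proof. by move=> QF u; rewrite -[u]laurent_frac_repr. Qed.

Lemma laurent_expand n j f :
  laurent_frac (n + j) (x ^+ n * f) = laurent_frac j f.
Proof. by apply/laurent_fracP; rewrite mulrA -exprD addnC. Qed.

(* x^-j f + x^-k g = x^-(j+k) (x^k f + x^j g) *)
Definition laurent_add (u v : L) : L :=
  laurent_frac ((repr u).1 + (repr v).1)
    (x ^+ (repr v).1 * (repr u).2 + x ^+ (repr u).1 * (repr v).2).

Definition laurent_opp (u : L) : L := laurent_frac (repr u).1 (- (repr u).2).

(* (x^-j f) (x^-k g) = x^-(j+k) alpha^k(f) g, because f x^-k = x^-k alpha^k(f) *)
Definition laurent_mul (u v : L) : L :=
  laurent_frac ((repr u).1 + (repr v).1)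
    (skew_extn (repr v).1 (repr u).2 * (repr v).2).

Definition laurent_embed f : L := laurent_frac 0 f.

Lemma repr_frac j f (r := repr (laurent_frac j f)) :
  x ^+ j * r.2 = x ^+ r.1 * f.
Proof. by apply/laurent_fracP; rewrite laurent_frac_repr. Qed.

Lemma laurent_addE j k f g :
  laurent_add (laurent_frac j f) (laurent_frac k g)
  = laurent_frac (j + k) (x ^+ k * f + x ^+ j * g).
Proof.
rewrite /laurent_add; have := repr_frac j f; have := repr_frac k g.
case: (repr (laurent_frac j f)) => j' f'; case: (repr _) => k' g' /= Eg Ef.
symmetry; apply/laurent_fracP; rewrite !mulrDr !mulrA -!exprD; congr (_ + _).
  have -> : (j' + k' + k = (k' + k) + j')%N by lia.
  have -> : (j + k + k' = (k' + k) + j)%N by lia.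
  by rewrite !exprD -!mulrA Ef.
have -> : (j' + k' + j = (j' + j) + k')%N by lia.
have -> : (j + k + j' = (j' + j) + k)%N by lia.
by rewrite !exprD -!mulrA Eg.
Qed.

Lemma laurent_oppE j f :
  laurent_opp (laurent_frac j f) = laurent_frac j (- f).
Proof.
rewrite /laurent_opp; have := repr_frac j f.
case: (repr _) => j' f' /= Ef.
by apply/laurent_fracP; rewrite !mulrN Ef.
Qed.

Lemma laurent_mulE j k f g :
  laurent_mul (laurent_frac j f) (laurent_frac k g)
  = laurent_frac (j + k) (skew_extn k f * g).
Proof.
rewrite /laurent_mul; have := repr_frac j f; have := repr_frac k g.
case: (repr (laurent_frac j f)) => j' f'; case: (repr _) => k' g' /= Eg Ef.
symmetry; apply/laurent_fracP.
have extX m n (p : P) : x ^+ n * skew_extn m p = skew_extn m (x ^+ n * p).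
  by rewrite rmorphM /= skew_extnXn.
have E1 : x ^+ j' * skew_extn k f = x ^+ j * skew_extn k f'.
  by rewrite !extX Ef.
have E2 : x ^+ k' * (skew_extn k f' * g) = x ^+ k * (skew_extn k' f' * g').
  rewrite mulrA skewXn_mul -skew_extnD -mulrA -Eg mulrA addnC skew_extnD.
  by rewrite -skewXn_mul -mulrA.
rewrite addnC exprD -mulrA [x ^+ j' * _]mulrA E1 -mulrA mulrA -exprD addnC.
by rewrite exprD -mulrA E2 mulrA -exprD.
Qed.

Lemma laurent_addA : associative laurent_add.
Proof.
elim/laurent_ind => j f; elim/laurent_ind => k g; elim/laurent_ind => l h.
rewrite !laurent_addE addnA; congr laurent_frac.
rewrite !mulrDr !mulrA -!exprD addrA.
by rewrite ![(l + _)%N]addnC.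
Qed.

Lemma laurent_addC : commutative laurent_add.
Proof.
elim/laurent_ind => j f; elim/laurent_ind => k g.
by rewrite !laurent_addE addnC addrC.
Qed.

Lemma laurent_add0 : left_id (laurent_embed 0) laurent_add.
Proof.
elim/laurent_ind => j f.
by rewrite laurent_addE mulr0 add0r mul1r.
Qed.

Lemma laurent_addN : left_inverse (laurent_embed 0) laurent_opp laurent_add.
Proof.
elim/laurent_ind => j f; rewrite laurent_oppE laurent_addE mulrN addNr.
by apply/laurent_fracP; rewrite !mulr0.
Qed.

HB.instance Definition _ :=
  GRing.isZmodule.Build L laurent_addA laurent_addC laurent_add0 laurent_addN.

Lemma laurent_mulA : associative laurent_mul.
Proof.
elim/laurent_ind => j f; elim/laurent_ind => k g; elim/laurent_ind => l h.
by rewrite !laurent_mulE addnA rmorphM /= [(k + l)%N]addnC skew_extnD mulrA.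
Qed.

Lemma laurent_mul1l : left_id (laurent_embed 1) laurent_mul.
Proof. by elim/laurent_ind => j f; rewrite laurent_mulE rmorph1 mul1r. Qed.

Lemma laurent_mul1r : right_id (laurent_embed 1) laurent_mul.
Proof. by elim/laurent_ind => j f; rewrite laurent_mulE mulr1 addn0. Qed.

Lemma laurent_mulDl : left_distributive laurent_mul laurent_add.
Proof.
elim/laurent_ind => j f; elim/laurent_ind => k g; elim/laurent_ind => l h.
rewrite laurent_addE !laurent_mulE laurent_addE -(laurent_expand l).
congr laurent_frac; first by lia.
rewrite rmorphD !rmorphM /= !skew_extnXn mulrDl mulrDr !mulrA -!exprD.
by rewrite ![(l + _)%N]addnC.
Qed.

Lemma laurent_mulDr : right_distributive laurent_mul laurent_add.
Proof.
elim/laurent_ind => l h; elim/laurent_ind => j f; elim/laurent_ind => k g.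
rewrite laurent_addE !laurent_mulE laurent_addE -(laurent_expand l).
congr laurent_frac; first by lia.
have extE m n p : skew_extn (m + n) h * (x ^+ m * p)
    = x ^+ m * (skew_extn n h * p).
  by rewrite !mulrA skewXn_mul -skew_extnD.
by rewrite mulrDr extE addnC extE mulrDr !mulrA -!exprD.
Qed.

HB.instance Definition _ := GRing.Zmodule_isPzRing.Build L
  laurent_mulA laurent_mul1l laurent_mul1r laurent_mulDl laurent_mulDr.

Lemma laurent_fracD j k f g : laurent_frac j f + laurent_frac k g
  = laurent_frac (j + k) (x ^+ k * f + x ^+ j * g).
Proof. exact: laurent_addE. Qed.

Lemma laurent_fracN j f : - laurent_frac j f = laurent_frac j (- f).
Proof. exact: laurent_oppE. Qed.

Lemma laurent_fracM j k f g : laurent_frac j f * laurent_frac k g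
  = laurent_frac (j + k) (skew_extn k f * g).
Proof. exact: laurent_mulE. Qed.

Lemma laurent_embed_zmod : zmod_morphism laurent_embed.
Proof.
by move=> f g; rewrite /laurent_embed laurent_fracN laurent_fracD !mul1r.
Qed.

Lemma laurent_embed_monoid : monoid_morphism laurent_embed.
Proof.
by split=> // f g; rewrite /laurent_embed laurent_fracM.
Qed.

HB.instance Definition _ :=
  GRing.isZmodMorphism.Build P L laurent_embed laurent_embed_zmod.
HB.instance Definition _ :=
  GRing.isMonoidMorphism.Build P L laurent_embed laurent_embed_monoid.

Lemma laurent_embed_inj : injective laurent_embed.
Proof. by move=> f g /laurent_fracP; rewrite !mul1r. Qed.

Definition laurentC (r : R) : L := laurent_embed (skewC alpha r).
Definition laurentX : L := laurent_embed x.
Definition laurentXV : L := laurent_frac 1 1.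

Lemma laurentXK : laurentX * laurentXV = 1.
Proof.
rewrite laurent_fracM mulr1 (skew_extnXn alpha 1 1).
by apply/laurent_fracP; rewrite mulr1 mul1r.
Qed.

Lemma laurentXVK : laurentXV * laurentX = 1.
Proof.
rewrite laurent_fracM mul1r.
by apply/laurent_fracP; rewrite mulr1 mul1r.
Qed.

Lemma laurentXC r : laurentX * laurentC r = laurentC (alpha r) * laurentX.
Proof.
rewrite -[LHS](rmorphM laurent_embed) -[RHS](rmorphM laurent_embed).
by rewrite skewX_mul skew_extU.
Qed.

Lemma laurentCXV r : laurentC r * laurentXV = laurentXV * laurentC (alpha r).
Proof.
rewrite -[laurentXV * _]mulr1 -laurentXK mulrA -[X in _ = X * _]mulrA.
by rewrite -laurentXC mulrA laurentXVK mul1r.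
Qed.

Lemma laurentXVn j : laurentXV ^+ j = laurent_frac j 1.
Proof.
by elim: j => // j IHj; rewrite exprS IHj laurent_fracM rmorph1 mulr1.
Qed.

Lemma laurent_fracE j f : laurent_frac j f = laurentXV ^+ j * laurent_embed f.
Proof.
by rewrite laurentXVn laurent_fracM rmorph1 mul1r addn0.
Qed.

Lemma laurent_normal (u : L) : exists (j n : nat) (r : nat -> R),
  u = \sum_(i < n) laurentXV ^+ j * laurentC (r i) * laurentX ^+ i.
Proof.
elim/laurent_ind: u => j f.
set n := (\max_(i <- msupp f) i).+1.
have fE : f = \sum_(i < n) skewC alpha (skew_coef i f) * x ^+ i.
  apply: skew_polyP => k; rewrite raddf_sum /=.
  under eq_bigr => i _ do rewrite skewCXn skew_coef_monom.
  case: (ltnP k n) => [lt_kn|ge_kn].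
    rewrite (bigD1 (Ordinal lt_kn)) //= eqxx big1 ?addr0 // => i.
    by rewrite -val_eqE /= => /negPf ->.
  rewrite big1 => [|i _]; last by rewrite (ltn_eqF (leq_trans (ltn_ord i) ge_kn)).
  apply: mcoeff_outdom; apply: contraL ge_kn => fk; rewrite -ltnNge ltnS.
  exact: (@leq_bigmax_seq _ _ predT id k fk).
exists j, n, (fun i => skew_coef i f).
rewrite laurent_fracE [in LHS]fE rmorph_sum mulr_sumr.
by apply: eq_bigr => i _; rewrite rmorphM rmorphXn mulrA.
Qed.

End SkewLaurent.

(* Main.v *)
(* In a semicommutative ring idempotents are central, and a ring with central *)
(* idempotents is right cP-Baer: r(eR) = (1 - e)R. Hence both rings are right *)
(* cP-Baer, once every idempotent of T = R[x, x^-1; alpha] is shown to be an  *)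
(* idempotent of R (T itself need not be semicommutative). The nilpotents of  *)
(* R form an ideal modulo which R is reduced and alpha rigid, so comparing    *)
(* extreme coefficients in e e = e leaves only a constant term modulo         *)
(* nilpotents, which lifts to an idempotent c of R, fixed by alpha and        *)
(* central in T. A difference d = e - c of commuting idempotents satisfies    *)
(* d^3 = d; here its coefficients are nilpotent, which places it in the       *)
(* Jacobson radical of T, and so d = 0.                                       *)

From HB Require Import structures.
Require Import Defs.
From mathcomp Require Import all_boot all_algebra.
From mathcomp Require Import zify.

Set Implicit Arguments.
Unset Strict Implicit.
Unset Printing Implicit Defensive.

Import GRing.Theory.
Local Open Scope ring_scope.

(** The weight lies on [laurent_idempotent]: each idempotent x^-j f of T is a constant [C c]. By
    [laurent_idempotent_coef], f is f_j x^j up to nilpotent coefficients and f_j^2 - f_j is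
    nilpotent; [idempotent_lift] gives c near f_j; [laurent_frac_in_jacobson] and [in_jacobson_cube]
    turn this congruence into an equality. *)

Definition central (R : pzRingType) (e : R) : Prop := forall r : R, GRing.comm e r.

Definition nilpotent_elt (R : pzRingType) (a : R) : Prop :=
  exists n : nat, a ^+ n = 0.

Lemma central_idempotents_cP_Baer (R : pzRingType) :
  (forall e : R, idempotent_elt e -> central e) -> right_cP_Baer R.
Proof.
move=> idemC e idem_e; exists (1 - e); split=> [|a].
  by rewrite /idempotent_elt mulrBr mulr1 mulrBl mul1r idem_e subrr subr0.
split=> [ann_a|[r ->] _ [s ->]].
  exists a; have /= := ann_a e; rewrite mulrBl mul1r => -> //; rewrite ?subr0 //.
  by exists 1; rewrite mulr1.
by rewrite (idemC e idem_e s) -mulrA [e * _]mulrA mulrBr mulr1 idem_e subrr mul0r mulr0.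
Qed.

(** e(1 - c) and c(1 - e) are orthogonal idempotents with difference e - c. *)
Lemma idempotentB_cube (T : pzRingType) (e c : T) :
  idempotent_elt e -> idempotent_elt c -> GRing.comm e c ->
  (e - c) * (e - c) * (e - c) = e - c.
Proof.
move=> idem_e idem_c ec.
have -> : (e - c) * (e - c) = e - e * c - (e * c - c).
  by rewrite mulrBl !mulrBr -ec idem_e idem_c.
rewrite !mulrBl !mulrBr -!mulrA -ec idem_c idem_e [e * (e * c)]mulrA idem_e.
by rewrite subrr subr0 sub0r opprK subrKA.
Qed.

(** * Coefficients of skew polynomials *)

Section SkewCoef.
Context (R : pzRingType) (alpha : {rmorphism R -> R}).
Implicit Types (f g : skew_poly alpha).

Lemma skew_coef_mulC f b i :
  skew_coef i (f * skewC alpha b) = skew_coef i f * iter i alpha b.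
Proof.
elim/skew_poly_ind: f => [|f1 f2 E1 E2|a j].
- by rewrite mul0r !raddf0 mul0r.
- by rewrite mulrDl !raddfD /= E1 E2 mulrDl.
rewrite skew_monomM addn0 !skew_coef_monom mulrnAl.
by case: eqP => [->|].
Qed.

Lemma skew_coefM f g n : skew_coef n (f * g) =
  \sum_(a < n.+1) skew_coef a f * iter a alpha (skew_coef (n - a) g).
Proof.
elim/skew_poly_ind: f => [|f1 f2 E1 E2|a i].
- by rewrite mul0r raddf0 big1 // => i _; rewrite raddf0 mul0r.
- rewrite mulrDl raddfD /= E1 E2 -big_split; apply: eq_bigr => i _.
  by rewrite raddfD mulrDl.
elim/skew_poly_ind: g => [|g1 g2 E1 E2|b j].
- by rewrite mulr0 raddf0 big1 // => k _; rewrite !raddf0 mulr0.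
- rewrite mulrDr raddfD /= E1 E2 -big_split; apply: eq_bigr => k _.
  by rewrite !raddfD mulrDr.
rewrite skew_monomM skew_coef_monom.
case: (leqP i n) => [le_in|lt_ni].
  rewrite (bigD1 (Ordinal (le_in : (i < n.+1)%N))) //= big1 => [|k].
    rewrite addr0 !skew_coef_monom eqxx rmorphMn /= mulrnAr.
    by rewrite -[j == _](eqn_add2l i) subnKC.
  rewrite -val_eqE /= => /negPf ki.
  by rewrite skew_coef_monom eq_sym ki mul0r.
rewrite big1 => [|k _]; first by rewrite (gtn_eqF (ltn_addr j lt_ni)).
rewrite skew_coef_monom gtn_eqF ?mul0r //.
by rewrite (leq_ltn_trans _ lt_ni) // -ltnS.
Qed.

Lemma skew_coef_bounded f :
  exists n, forall i, (n <= i)%N -> skew_coef i f = 0.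
Proof.
elim/skew_poly_ind: f => [|f1 f2 [n1 f1n] [n2 f2n]|a j].
- by exists 0%N => i _; rewrite raddf0.
- exists (maxn n1 n2) => i; rewrite geq_max => /andP [n1i n2i].
  by rewrite raddfD /= f1n // f2n // addr0.
by exists j.+1 => i ji; rewrite skew_coef_monom ltn_eqF.
Qed.

Lemma skew_coef_extn j i f :
  skew_coef i (skew_extn j f) = iter j alpha (skew_coef i f).
Proof. by elim: j => //= j <-; rewrite skew_coef_ext. Qed.

End SkewCoef.

(** * The Jacobson radical through left inverses *)

Section JacobsonRadical.
Context (T : pzRingType).
Implicit Types (t u v w z : T).

Definition in_jacobson z : Prop := forall t, exists v, v * (1 - t * z) = 1.

Lemma in_jacobson0 : in_jacobson 0.
Proof. by move=> t; exists 1; rewrite mulr0 subr0 mul1r. Qed.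

(** If v(1 - tz) = 1, then v(1 - t(z + w)) = 1 - (vt)w, to which the hypothesis on w applies. *)
Lemma in_jacobsonD z w : in_jacobson z -> in_jacobson w -> in_jacobson (z + w).
Proof.
move=> Jz Jw t; have [v vz] := Jz t; have [v' v'w] := Jw (v * t).
exists (v' * v); rewrite -mulrA (mulrDr t) opprD addrA [v * _]mulrBr vz.
by rewrite [v * (t * w)]mulrA.
Qed.

Lemma in_jacobsonMl t z : in_jacobson z -> in_jacobson (t * z).
Proof. by move=> Jz s; have [v] := Jz (s * t); exists v; rewrite mulrA. Qed.

(** With y = x^-1, 1 - tzx = y(1 - xtz)x. This absorbs powers of [X] on the right without proving
    the radical two-sided. *)
Lemma in_jacobson_unit z x y :
  x * y = 1 -> y * x = 1 -> in_jacobson z -> in_jacobson (z * x).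
Proof.
move=> xy yx Jz t; have [v vz] := Jz (x * t).
exists (y * v * x).
have -> : y * v * x * (1 - t * (z * x)) = y * (v * (1 - x * t * z)) * x.
  by rewrite !(mulrBr, mulrBl) !mulr1 !mulrA.
by rewrite vz mulr1 yx.
Qed.

Lemma nilpotent_in_jacobson z :
  (forall t, nilpotent_elt (t * z)) -> in_jacobson z.
Proof.
move=> nz t; have [n tzn] := nz t; exists (\sum_(i < n) (t * z) ^+ i).
have cz : GRing.comm (\sum_(i < n) (t * z) ^+ i) (1 - t * z).
  apply/commr_sym/commr_sum => i _; apply/commrX/commr_sym/commrB => //.
  exact: commr1.
by rewrite cz -[1 - t * z]opprB mulNr -subrX1 tzn sub0r opprK.
Qed.

Lemma in_jacobson_cube z : in_jacobson z -> z * z * z = z -> z = 0.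
Proof.
move=> Jz z3; have [v vz] := Jz z.
by rewrite -[LHS]mul1r -vz -mulrA mulrBl mul1r z3 subrr mulr0.
Qed.

End JacobsonRadical.

(** * Nilpotent elements of a semicommutative ring *)

Section Nilpotent.
Context (R : pzRingType).
Local Notation nil := (@nilpotent_elt R).
Implicit Types a b : R.

Lemma nilpotent0 : nil 0.
Proof. by exists 1%N. Qed.

Lemma nilpotentN a : nil a -> nil (- a).
Proof. by move=> [m am]; exists m; rewrite exprNn am mulr0. Qed.

Lemma nilpotentC a b : nil (a * b) -> nil (b * a).
Proof.
move=> [n abn]; exists n.+1.
have exprMS m : (b * a) ^+ m.+1 = b * (a * b) ^+ m * a.
  elim: m => [|m IHm]; first by rewrite !expr1 mulr1.
  by rewrite exprSr IHm [(a * b) ^+ m.+1]exprSr !mulrA.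
by rewrite exprMS abn mulr0 mul0r.
Qed.

End Nilpotent.

Section Semicommutative.
Context (R : pzRingType) (semicommR : semicommutative R).
Local Notation nil := (@nilpotent_elt R).
Implicit Types (a b c e p r u v : R) (m n : nat).

Lemma semicommutative_idempotent_central e : idempotent_elt e -> central e.
Proof.
move=> idem_e r; rewrite /GRing.comm.
have e1e : e * (1 - e) = 0 by rewrite mulrBr mulr1 idem_e subrr.
have e2e : (1 - e) * e = 0 by rewrite mulrBl mul1r idem_e subrr.
have /eqP := semicommR e1e r; rewrite mulrBr mulr1 subr_eq0 => /eqP ->.
by have /eqP := semicommR e2e r; rewrite mulrBl mul1r mulrBl subr_eq0 => /eqP ->.
Qed.

(** The prefix u makes the induction work: peeling off one factor a + b moves a or b into u,
    lowering m or n, and the other equation survives because a factor may be inserted after u. *)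
Lemma semicommutative_expD u a b m n :
  u * a ^+ m = 0 -> u * b ^+ n = 0 -> u * (a + b) ^+ (m + n) = 0.
Proof.
elim: m n u => [|m IHm] n u; first by rewrite mulr1 => ->; rewrite !mul0r.
elim: n u => [|n IHn] u; first by rewrite mulr1 => _ ->; rewrite mul0r.
move=> ua ub; rewrite addSn exprS mulrA mulrDr mulrDl.
rewrite IHm ?add0r; last 2 first.
- by rewrite -mulrA -exprS.
- by have := semicommR ub a.
rewrite -addSnnS IHn //; first by have := semicommR ua b.
by rewrite -mulrA -exprS.
Qed.

Lemma nilpotentD a b : nil a -> nil b -> nil (a + b).
Proof.
move=> [m am] [n bn]; exists (m + n)%N; rewrite -[LHS]mul1r.
by apply: semicommutative_expD; rewrite mul1r.
Qed.

Lemma nilpotentB a b : nil a -> nil b -> nil (a - b).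
Proof. by move=> na nb; apply: nilpotentD => //; apply: nilpotentN. Qed.

Lemma nilpotent_sum (I : Type) (s : seq I) (P : pred I) (F : I -> R) :
  (forall i, P i -> nil (F i)) -> nil (\sum_(i <- s | P i) F i).
Proof.
move=> nF; elim/big_ind: _ => //; [exact: nilpotent0 | exact: nilpotentD].
Qed.

Lemma nilpotentMl r a : nil a -> nil (r * a).
Proof.
move=> [n an]; exists n.
have step m u : u * a ^+ m = 0 -> u * (r * a) ^+ m = 0.
  elim: m u => [//|m IHm] u uam; rewrite exprS mulrA IHm //.
  by rewrite mulrA -(mulrA _ a) -exprS semicommR.
by rewrite -[LHS]mul1r step // mul1r.
Qed.

Lemma nilpotentMr r a : nil a -> nil (a * r).
Proof. by move=> na; apply/nilpotentC/nilpotentMl. Qed.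

Lemma nilpotent_exprB p n : nil (p * p - p) -> nil (p ^+ n.+1 - p).
Proof.
move=> nilp; elim: n => [|n IHn]; first by rewrite subrr; apply: nilpotent0.
rewrite exprS -(subrKA (p * p)) -mulrBr.
by apply: nilpotentD => //; apply: nilpotentMl.
Qed.

(* [c := 1 - (1 - p ^ n) ^ n] is a multiple of [p ^ n], and [1 - c] one of    *)
(* [(1 - p) ^ n].                                                             *)
Lemma idempotent_lift p :
  nil (p * p - p) -> exists c, idempotent_elt c /\ nil (c - p).
Proof.
move=> nilp; have [k pk] := nilp.
(* The exponent must be positive for p^n to be congruent to p modulo nilpotents. *)
pose n := k.+1; pose q := 1 - p ^+ n; exists (1 - q ^+ n).
have pn : p ^+ n * (1 - p) ^+ n = 0.
  rewrite -exprMn_comm; last by apply: commrB; [exact: commr1 | ].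
  by rewrite mulrBr mulr1 -opprB exprNn [X in _ * X]exprS pk !mulr0.
have qE : q = (1 - p) * \sum_(i < n) p ^+ i.
  by rewrite /q -opprB subrX1 -mulNr opprB.
have qnE : q ^+ n = (1 - p) ^+ n * (\sum_(i < n) p ^+ i) ^+ n.
  rewrite {1}qE exprMn_comm //; apply: commr_sum => i _; apply: commrX.
  by apply/commr_sym/commrB; [exact: commr1 | ].
have cE : 1 - q ^+ n = p ^+ n * \sum_(i < n) q ^+ i.
  by rewrite -opprB subrX1 -mulNr opprB /q subKr.
(* Semicommutativity inserts the cofactor of p^n into p^n (1 - p)^n = 0. *)
have cq : (1 - q ^+ n) * q ^+ n = 0.
  by rewrite cE qnE mulrA (semicommR pn) mul0r.
split; first by rewrite /idempotent_elt mulrBr mulr1 cq subr0.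
have npn := nilpotent_exprB k nilp.
have nq : nil (q * q - q).
  have -> : q * q - q = p ^+ n * p ^+ n - p ^+ n.
    by rewrite {2}/q mulrBr mulr1 addrAC subrr sub0r mulrBl mul1r opprB.
  rewrite -exprD -(subrKA p) -[p - _]opprB.
  by apply: nilpotentB => //; exact: (nilpotent_exprB (k + n)).
have -> : 1 - q ^+ n - p = (p ^+ n - p) - (q ^+ n - q).
  rewrite opprB addrC {2}/q -addrA [RHS]addrCA; congr (_ + _).
  by rewrite [RHS]addrA subrKC.
by apply: nilpotentB => //; exact: (nilpotent_exprB k).
Qed.

End Semicommutative.

(** * Compatibility: zero products and nilpotents under [alpha] *)

Section Compatible.
Context (R : pzRingType) (alpha : {rmorphism R -> R}) (compat_alpha : compatible alpha).
Local Notation nil := (@nilpotent_elt R).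
Implicit Types (a b e u v : R).

Lemma compatible_iter i a b : a * b = 0 <-> a * iter i alpha b = 0.
Proof. by elim: i => [//|i IHi]; apply: (iff_trans IHi); exact: compat_alpha. Qed.

(** Apply the iterate to the whole of bv, then remove it from v alone. *)
Lemma compatible_mid i u b v : u * b * v = 0 <-> u * iter i alpha b * v = 0.
Proof.
rewrite -mulrA (compatible_iter i) rmorphM mulrA.
exact: iff_sym (compatible_iter i _ v).
Qed.

Lemma nilpotentM_iter i a b : nil (a * iter i alpha b) <-> nil (a * b).
Proof.
have gen n u : u * (a * iter i alpha b) ^+ n = 0 <-> u * (a * b) ^+ n = 0.
  elim: n u => [//|n IHn] u.
  by rewrite !exprS !mulrA -compatible_mid IHn.
by split=> -[n]; rewrite -[_ ^+ n]mul1r => /gen; rewrite mul1r; exists n.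
Qed.

Lemma nilpotent_iter i a : nil (iter i alpha a) <-> nil a.
Proof. by have := nilpotentM_iter i 1 a; rewrite !mul1r. Qed.

(** This is rigidity of [alpha] modulo nilpotents: both iterates are stripped off, exchanging the
    factors in between, until a a is nilpotent. *)
Lemma nilpotent_iter_sqr i j a : nil (iter i alpha a * iter j alpha a) -> nil a.
Proof.
move/nilpotentM_iter/nilpotentC/nilpotentM_iter => [n an].
by exists (n + n)%N; rewrite -an exprMn_comm // exprD.
Qed.

(** Compatibility turns e(1 - e) = 0 into e = e alpha(e), and (1 - e)e = 0 into alpha(e) = e
    alpha(e). *)
Lemma idempotent_fixed e : idempotent_elt e -> alpha e = e.
Proof.
move=> idem_e.
have /compat_alpha/eqP: e * (1 - e) = 0 by rewrite mulrBr mulr1 idem_e subrr.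
rewrite rmorphB rmorph1 mulrBr mulr1 subr_eq0 => /eqP eE.
have /compat_alpha/eqP: (1 - e) * e = 0 by rewrite mulrBl mul1r idem_e subrr.
by rewrite mulrBl mul1r -eE subr_eq0 => /eqP.
Qed.

End Compatible.

(** * Idempotents of the skew Laurent ring *)

Section Laurent.
Context (R : pzRingType) (alpha : {rmorphism R -> R}).
Context (semicommR : semicommutative R) (compat_alpha : compatible alpha).
Let alpha_inj := compatible_inj compat_alpha.
Local Notation T := (skew_laurent alpha_inj).
Local Notation C := (laurentC alpha_inj).
Local Notation X := (laurentX alpha_inj).
Local Notation XV := (laurentXV alpha_inj).
Local Notation frac := (laurent_frac alpha_inj).
Local Notation nil := (@nilpotent_elt R).
Implicit Types (f g : skew_poly alpha) (u t : T) (a b c r : R).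

Lemma laurentC_zmod : zmod_morphism C.
Proof. by move=> a b; rewrite /laurentC !rmorphB. Qed.
Lemma laurentC_monoid : monoid_morphism C.
Proof. by split=> [|a b]; rewrite /laurentC ?rmorph1 ?rmorphM. Qed.
HB.instance Definition _ := GRing.isZmodMorphism.Build R T C laurentC_zmod.
HB.instance Definition _ := GRing.isMonoidMorphism.Build R T C laurentC_monoid.

Lemma laurent_frac_eq0 j f : frac j f = 0 <-> f = 0.
Proof.
split=> [/laurent_fracP|->]; last by apply/laurent_fracP; rewrite !mulr0.
by rewrite mul1r mulr0.
Qed.

Lemma laurent_frac_mulC_eq0 j f b :
  frac j f * C b = 0 <-> forall i, skew_coef i f * b = 0.
Proof.
rewrite laurent_fracM laurent_frac_eq0; split=> [fb0 i|fb0].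
  by apply/(compatible_iter compat_alpha i); rewrite -skew_coef_mulC fb0 raddf0.
apply: skew_polyP => i; rewrite skew_coef_mulC raddf0.
by have [-> //] := compatible_iter compat_alpha i (skew_coef i f) b.
Qed.

Lemma laurent_mulC_alpha_eq0 u b : u * C b = 0 <-> u * C (alpha b) = 0.
Proof.
elim/laurent_ind: u => j f; rewrite !laurent_frac_mulC_eq0.
by split=> fb0 i; have [ab ba] := compat_alpha (skew_coef i f) b; auto.
Qed.

(** Insertion before a constant: it suffices to insert the generators [X], [XV] and constants, and
    passing b across [X] or [XV] only costs an [alpha]. *)
Lemma laurent_semicommC u t b : u * C b = 0 -> u * t * C b = 0.
Proof.
move=> ub0.
have mulXV v : v * C b = 0 -> v * XV * C b = 0.
  move=> vb0; apply/laurent_mulC_alpha_eq0.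
  by rewrite -mulrA -laurentCXV mulrA vb0 mul0r.
have mulX v : v * C b = 0 -> v * X * C b = 0.
  by move/laurent_mulC_alpha_eq0 => vb0; rewrite -mulrA laurentXC mulrA vb0 mul0r.
have mulC v a : v * C b = 0 -> v * C a * C b = 0.
  elim/laurent_ind: v => j f; rewrite -mulrA -rmorphM !laurent_frac_mulC_eq0.
  by move=> fb0 i; rewrite mulrA semicommR.
have mulXn n v : v * C b = 0 -> v * X ^+ n * C b = 0.
  elim: n v => [|n IHn] v vb0; first by rewrite mulr1.
  by rewrite exprS mulrA IHn // mulX.
have mulXVn n v : v * C b = 0 -> v * XV ^+ n * C b = 0.
  elim: n v => [|n IHn] v vb0; first by rewrite mulr1.
  by rewrite exprS mulrA IHn // mulXV.
have [j [n [r ->]]] := laurent_normal t.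
rewrite mulr_sumr mulr_suml big1 // => i _.
by rewrite !mulrA mulXn // mulC // mulXVn.
Qed.

Lemma laurentC_in_jacobson r : nil r -> in_jacobson (C r).
Proof.
move=> [n rn]; apply: nilpotent_in_jacobson => t; exists n.
have step m u : u * C (r ^+ m) = 0 -> u * (t * C r) ^+ m = 0.
  elim: m u => [|m IHm] u; first by rewrite rmorph1.
  move=> um; rewrite exprS mulrA IHm //.
  by rewrite mulrA -(mulrA _ (C r)) -rmorphM -exprS laurent_semicommC.
by rewrite -[LHS]mul1r step // rn rmorph0 mulr0.
Qed.

Lemma laurent_frac_in_jacobson j f :
  (forall i, nil (skew_coef i f)) -> in_jacobson (frac j f).
Proof.
move=> nf; rewrite laurent_fracE; apply: in_jacobsonMl.
rewrite [f]skew_polyE rmorph_sum /=.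
elim/big_ind: _ => [||i _]; [exact: in_jacobson0 | exact: in_jacobsonD | ].
rewrite -skewCXn rmorphM rmorphXn -/(laurentC _ _).
have Jr := laurentC_in_jacobson (nf i).
elim: {2}i => [|n IHn]; first by rewrite mulr1.
rewrite exprSr mulrA.
by apply: in_jacobson_unit IHn; [exact: laurentXK | exact: laurentXVK].
Qed.

Lemma laurent_idempotent_coef j f : idempotent_elt (frac j f) ->
  (forall k, k != j -> nil (skew_coef k f)) /\
  nil (skew_coef j f * skew_coef j f - skew_coef j f).
Proof.
rewrite /idempotent_elt laurent_fracM => /laurent_fracP.
rewrite exprD -mulrA => /(skewXn_lreg alpha_inj j) idem_f.
pose g := f - skewX alpha ^+ j.
(* Idempotency says alpha^j(f) f = x^j f, and x^j f = alpha^j(f) x^j. *)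
have fg0 : skew_extn j f * g = 0.
  by rewrite mulrBr -skewXn_mul -idem_f; apply/eqP; rewrite subr_eq0.
have gE k : skew_coef k g = skew_coef k f - (j == k)%:R.
  by rewrite raddfB /= skewXn skew_coef_monom.
have gE_neq k : k != j -> skew_coef k g = skew_coef k f.
  by rewrite gE eq_sym => /negPf ->; rewrite subr0.
have diag n (ln : (n <= n + n)%N) :
    (forall k, (k <= n + n)%N -> k != n ->
       nil (skew_coef k f) \/ nil (skew_coef (n + n - k) g)) ->
    nil (iter j alpha (skew_coef n f) * iter n alpha (skew_coef n g)).
  move=> nfg; have := skew_coefM (skew_extn j f) g (n + n).
  rewrite fg0 raddf0 (bigD1 (Ordinal (ln : n < (n + n).+1)%N)) //= addnK.
  rewrite skew_coef_extn => /esym/eqP; rewrite addr_eq0 => /eqP ->.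
  apply/nilpotentN/nilpotent_sum => // k; rewrite -val_eqE /= => kn.
  rewrite skew_coef_extn; have [||nf|ng] := nfg k => //; first by rewrite -ltnS.
    by apply: nilpotentMr => //; apply/nilpotent_iter.
  by apply: nilpotentMl => //; apply/nilpotent_iter.
have nf k : k != j -> nil (skew_coef k f).
  have [M fM] := skew_coef_bounded f.
  (* In alpha^j(f) g = 0, every term of index 2n other than the n-th has a     *)
  (* factor whose index is farther from j than n: induct downwards on the      *)
  (* distance to j.                                                            *)
  have far s k' : k' != j -> (M + j <= (k' - j) + (j - k') + s)%N ->
      nil (skew_coef k' f).
    elim: s k' => [|s IHs] n nj les.
      (* The truncated differences add up to |n - j|; when this is at least M + j, the index n is at
         least M, since an index below j is within j of it. *)
      by rewrite fM; [exact: nilpotent0 | lia].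
    apply: (nilpotent_iter_sqr compat_alpha (i := j) (j := n)).
    rewrite -{2}(gE_neq n nj); apply: diag => [|m lem mn]; first by lia.
    (* m and 2n - m are distinct and symmetric about n, so one lies beyond n as seen from j. *)
    have [far_m | far_nm] : ((m - j) + (j - m) > (n - j) + (j - n) \/
        (n + n - m - j) + (j - (n + n - m)) > (n - j) + (j - n))%N by lia.
      by left; apply: IHs; lia.
    by right; rewrite gE_neq; [apply: IHs|]; lia.
  by move=> kj; apply: (far (M + j)%N) => //; rewrite leq_addl.
(* At index 2j the middle term is alpha^j(f_j (f_j - 1)). *)
split=> //; have := diag j (leq_addr _ _).
rewrite gE eqxx -rmorphM nilpotent_iter // mulrBr mulr1; apply=> k _ kj.
by left; apply: nf.
Qed.

Lemma laurentC_idempotent_central c : idempotent_elt c -> central (C c).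
Proof.
move=> idem_c t; have alpha_c := idempotent_fixed compat_alpha idem_c.
have [j [n [r ->]]] := laurent_normal t.
apply: commr_sum => i _; apply: commrM; last first.
  by apply: commrX; rewrite /GRing.comm laurentXC alpha_c.
apply: commrM; first by apply: commrX; rewrite /GRing.comm laurentCXV alpha_c.
rewrite /GRing.comm -!rmorphM.
by rewrite (semicommutative_idempotent_central semicommR idem_c).
Qed.

Lemma laurent_idempotent (e : T) : idempotent_elt e ->
  exists c, idempotent_elt c /\ e = C c.
Proof.
elim/laurent_ind: e => j f idem_e.
have [nf nfj] := laurent_idempotent_coef idem_e.
have [c [idem_c ncf]] := idempotent_lift semicommR nfj.
exists c; split=> //; apply/eqP; rewrite -subr_eq0; apply/eqP.
have idem_C : idempotent_elt (C c) by rewrite /idempotent_elt -rmorphM idem_c.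
apply: in_jacobson_cube.
  (* [alpha] fixes c, so x^j c = c x^j and [C c] is the fraction x^-j (c x^j). *)
  have -> : frac j f - C c = frac j (f - skew_monom alpha c j).
    rewrite /laurentC /laurent_embed laurent_fracN laurent_fracD addn0 mul1r.
    rewrite mulrN skewXn skew_monomM mul1r addn0.
    congr (frac j (_ - skew_monom alpha _ j)).
    by elim: (j) => //= i ->; apply: idempotent_fixed.
  apply: laurent_frac_in_jacobson => i; rewrite raddfB /= skew_coef_monom.
  have [<-|ji] := eqVneq j i; first by rewrite -opprB; apply: nilpotentN.
  by rewrite subr0; apply: nf; rewrite eq_sym.
apply: idempotentB_cube => //.
exact/commr_sym/laurentC_idempotent_central.
Qed.

End Laurent.

Theorem theorem2p28 (R : pzRingType) (alpha : {rmorphism R -> R})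
    (semicommR : semicommutative R) (compat_alpha : compatible alpha) :
  right_cP_Baer R <-> right_cP_Baer (skew_laurent (compatible_inj compat_alpha)).
Proof.
split=> _; apply: central_idempotents_cP_Baer => e idem_e.
  have [c [idem_c ->]] := laurent_idempotent semicommR idem_e.
  exact: laurentC_idempotent_central.
exact: semicommutative_idempotent_central.
Qed.
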